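(* The complete graph $K_n$ exhibits PGFR if and only if $n=2$.
   Context: For a graph $\Gamma$ with adjacency matrix $A$, the transition matrix is $H(t)=\exp(-\mathbf{i}tA)$, $t\in\mathbb{R}$, and $\mathbf{e}_v$ is the standard basis vector of vertex $v$. $\Gamma$ exhibits pretty good fractional revival (PGFR) between distinct vertices $a$ and $b$ if there is a sequence of real numbers $\{t_k\}$ with $\lim_{k\to\infty}H(t_k)\mathbf{e}_a=\alpha\mathbf{e}_a+\beta\mathbf{e}_b$ for some $\alpha,\beta\in\mathbb{C}$ with $\beta\neq0$ and $|\alpha|^2+|\beta|^2=1$; $\Gamma$ exhibits PGFR if it does so between some pair of distinct vertices. *)

(* Defs.v *)
From HB Require Import structures.
From mathcomp Require Import all_boot all_order all_algebra.
From mathcomp Require Import complex.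
From mathcomp Require Import all_classical all_reals all_analysis.

Set Implicit Arguments.
Unset Strict Implicit.
Unset Printing Implicit Defensive.

Import Order.TTheory GRing.Theory Num.Theory.
Import numFieldNormedType.Exports.

Local Open Scope classical_set_scope.
Local Open Scope ring_scope.

(* The complex numbers over R. MathComp-Analysis attaches its topology to the
   sort of a numClosedFieldType, and does not find it on the bare type R[i];
   hence this packed alias, which is convertible to R[i]. *)
Definition Cplx (R : realType) : numClosedFieldType := R[i].

Definition expmx_coeff (R : realType) (n : nat) (M : 'M[Cplx R]_n) (k : nat) :
  'M[Cplx R]_n := (k`!%:R)^-1 *: M ^+ k.

(* The limit is taken in the product (entrywise) topology on matrices. *)
Definition expmx (R : realType) (n : nat) (M : 'M[Cplx R]_n) : 'M[Cplx R]_n :=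
  limn (series (expmx_coeff M)).

Record sgraph (n : nat) := SGraph {
  adj : rel 'I_n;
  adj_sym : symmetric adj;
  adj_irr : irreflexive adj }.

Definition complete_adj (n : nat) : rel 'I_n := fun u v => u != v.

Lemma complete_adj_sym n : symmetric (@complete_adj n).
Proof. by move=> u v; rewrite /complete_adj eq_sym. Qed.

Lemma complete_adj_irr n : irreflexive (@complete_adj n).
Proof. by move=> u; rewrite /complete_adj eqxx. Qed.

Definition complete_graph (n : nat) : sgraph n :=
  SGraph (@complete_adj_sym n) (@complete_adj_irr n).

Definition adjmx (R : realType) (n : nat) (G : sgraph n) : 'M[Cplx R]_n :=
  \matrix_(u, v) (adj G u v)%:R.

Definition transition (R : realType) (n : nat) (G : sgraph n) (t : R) :
  'M[Cplx R]_n :=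
  expmx (((0 -i* t)%C : Cplx R) *: adjmx R G).

Definition evec (R : realType) (n : nat) (v : 'I_n) : 'cV[Cplx R]_n :=
  delta_mx v ord0.

Definition PGFR_between (R : realType) (n : nat) (G : sgraph n) (a b : 'I_n) :
  Prop :=
  exists (t : nat -> R) (alpha beta : Cplx R),
    [/\ (fun k => transition G (t k) *m evec R a) @ \oo -->
          alpha *: evec R a + beta *: evec R b,
        beta != 0
      & `|alpha| ^+ 2 + `|beta| ^+ 2 = 1].

Definition PGFR (R : realType) (n : nat) (G : sgraph n) : Prop :=
  exists a b : 'I_n, a != b /\ PGFR_between R G a b.

(* Main.v *)
(* Given distinct vertices a and b of K_n with n <> 2, pick a third vertex c. The
   transposition (b c) is an automorphism of K_n fixing a, so H(t) e_a has
   equal entries at b and c for every t; in the limit these entries are beta and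
   0, so beta = 0. For n = 2 the adjacency matrix A satisfies A^2 = 1, whence
   H(t) = cos t - i sin t A and H(pi / 2) e_a = - i e_b. *)
Require Import Defs.
From mathcomp Require Import all_boot all_order all_algebra.
From mathcomp Require Import perm complex ring.
From mathcomp Require Import all_classical all_reals all_analysis.

Set Implicit Arguments.
Unset Strict Implicit.
Unset Printing Implicit Defensive.

Import Order.TTheory GRing.Theory Num.Theory.
Import numFieldNormedType.Exports.

Local Open Scope classical_set_scope.
Local Open Scope ring_scope.

(** Basic neighbourhoods of [L] are products of neighbourhoods of its entries; as there are finitely
    many entries, the eventual conditions on them can be intersected. *)
Lemma cvg_mxP (K : numFieldType) (m n : nat) (T : Type) (F : set_system T)
    (FF : Filter F) (M : T -> 'M[K]_(m, n)) (L : 'M[K]_(m, n)) :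
  M @ F --> L <-> forall i j, M x i j @[x --> F] --> L i j.
Proof.
split=> [ML i j|ML A [P LP PA]].
  exact: (@cvg_comp _ _ _ M (fun N : 'M[K]_(m, n) => N i j) F _ _ ML
            (@coord_continuous K m n i j L)).
have near_P : \forall x \near F, forall i j, P i j (M x i j).
  by apply: filter_forall => i; apply: filter_forall => j; exact: ML (LP i j).
apply: (@filterS _ F FF _ _ _ near_P) => x Px; apply: PA => i j; exact: Px.
Qed.

Lemma cvg_mx_lim (K : numFieldType) (m n : nat) (u : nat -> 'M[K]_(m, n))
  (L : 'M[K]_(m, n)) : u @ \oo --> L -> limn u = L.
Proof.
move=> uL; have /cvg_mxP ulim : u @ \oo --> limn u by apply/cvg_ex; exists L.
move/cvg_mxP : uL => uL; apply/matrixP => i j.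
exact: (@cvg_unique K (@norm_hausdorff _ K) _ _ (limn u i j) (L i j)
          (ulim i j) (uL i j)).
Qed.

(* A divergent [u] has the junk limit 0, which also satisfies the conclusion, so
   convergence need not be assumed. *)
Lemma limn_mx_coord_eq (K : numFieldType) (m n : nat)
    (u : nat -> 'M[K]_(m, n)) (i i' : 'I_m) (j j' : 'I_n) :
  (forall k, u k i j = u k i' j') -> (limn u) i j = (limn u) i' j'.
Proof.
move=> uE; have [/cvg_mxP ucvg|/dvgP ->] := pselect (cvgn u); last first.
  by rewrite !mxE.
have := ucvg i j; rewrite (_ : (fun k => u k i j) = fun k => u k i' j').
  move=> ucvg'; exact: (@cvg_unique K (@norm_hausdorff _ K) _ _
    (limn u i j) (limn u i' j') ucvg' (ucvg i' j')).
exact/funext.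
Qed.

(** Each power of [M] commutes with the transposition matrix. As the transposition fixes [a],
    comparing the [(b, a)] entries of the two products equates the entries of that power at [(c, a)]
    and [(b, a)]. *)
Lemma expmx_comm_tperm_coord (R : realType) (n : nat) (M : 'M[Cplx R]_n)
    (a b c : 'I_n) :
  a != b -> a != c -> GRing.comm (tperm_mx b c) M ->
  expmx M b a = expmx M c a.
Proof.
move=> ab ac Mcomm; apply: limn_mx_coord_eq => k.
rewrite seriesEord /= !summxE; apply: eq_bigr => i _.
rewrite /expmx_coeff !mxE; congr (_ * _).
have : tperm_mx b c *m (M ^+ i) = (M ^+ i) *m tperm_mx b c.
  exact: (commrX i Mcomm).
move=> /matrixP /(_ b a); rewrite /tperm_mx -row_permE -[X in perm_mx X]tpermV.
rewrite -col_permE !mxE.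
by rewrite tpermL tpermD // eq_sym.
Qed.

Lemma cvg_real_complex (R : realType) (T : Type) (F : set_system T)
    (FF : Filter F) (f : T -> R) (l : R) :
  f @ F --> l -> ((f x)%:C%C : Cplx R) @[x --> F] --> (l%:C%C : Cplx R).
Proof.
move=> fl; apply/cvgrPdist_lt => e e0.
(* A positive complex number is real, so [e] reduces to its real part. *)
case: e e0 => er ei; rewrite (ltcE (0 : R[i])) /= => /andP[/eqP -> er0].
have /cvgrPdist_lt /(_ _ er0) := fl; apply: filterS => x flt.
rewrite [X in X < _](_ : _ = `|l - f x|%:C%C) ?ltcR //.
by rewrite -rmorphB (normc_def ((l - f x)%:C%C)) /= expr0n addr0 sqrtr_sqr.
Qed.

Lemma exprZmx (K : comPzRingType) (n : nat) (a : K) (A : 'M[K]_n) (k : nat) :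
  (a *: A) ^+ k = a ^+ k *: A ^+ k.
Proof.
elim: k => [|k IH]; first by rewrite !expr0 scale1r.
by rewrite !exprS IH -[LHS]/(_ *m _) -scalemxAl -scalemxAr scalerA.
Qed.

(** Even powers of [A] are 1 and odd ones are [A], while [cos_coeff] vanishes at odd and [sin_coeff]
    at even indices, so one formula covers both parities. *)
Lemma expmx_coeff_invol (R : realType) (n : nat) (A : 'M[Cplx R]_n) (t : R)
    (k : nat) :
  A ^+ 2 = 1 ->
  expmx_coeff (((0 -i* t)%C : Cplx R) *: A) k =
  ((cos_coeff t k)%:C%C : Cplx R) *: 1%:M +
  ((0 -i* sin_coeff t k)%C : Cplx R) *: A.
Proof.
move=> A2; rewrite /expmx_coeff /cos_coeff /sin_coeff /=.
have fE : (k`!%:R^-1 : Cplx R) = (k`!%:R^-1)%:C%C by rewrite fmorphV rmorph_nat.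
have z2 : (0 -i* t)%C ^+ 2 = (- t ^+ 2)%:C%C :> Cplx R.
  rewrite expr2 -[LHS]/(mulc _ _) /=; by simpc; rewrite expr2.
have AE h : A ^+ (2 * h) = 1 by rewrite exprM A2 expr1n.
rewrite exprZmx fE scalerA -[k](odd_double_half k) -mul2n; set h := k./2.
have zE a b : (a%:C * (0 -i* b))%C = (0 -i* (a * b))%C :> Cplx R.
  by rewrite -[LHS]/(mulc _ _) /=; simpc.
have oddE : odd (2 * h) = false by rewrite mul2n odd_double.
have halfE : (2 * h)./2 = h by rewrite mul2n doubleK.
have zhE : ((0 -i* t)%C : Cplx R) ^+ (2 * h) = ((-1) ^+ h * t ^+ (2 * h))%:C%C.
  by rewrite exprM z2 -rmorphXn [in LHS]exprNn [in RHS]exprM.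
case: (odd k); rewrite ?add0n ?add1n.
  rewrite /= !exprS AE zhE oddE halfE !mul0r scale0r add0r mulr1 mul1r.
  rewrite [X in _ * X]mulrC mulrA -rmorphM zE; congr ((0 -i* _)%C *: _); ring.
rewrite AE zhE -rmorphM oddE halfE !mul0r mul1r /=.
rewrite oppr0 [X in X *: A](_ : _ = 0) // scale0r addr0.
by congr (_%:C%C *: _); rewrite mulrC.
Qed.

Lemma expmx_invol (R : realType) (n : nat) (A : 'M[Cplx R]_n) (t : R) :
  A ^+ 2 = 1 ->
  expmx (((0 -i* t)%C : Cplx R) *: A) =
  ((cos t)%:C%C : Cplx R) *: 1%:M + ((0 -i* sin t)%C : Cplx R) *: A.
Proof.
have imE s : (0 -i* s)%C = - (('i%C : Cplx R) * s%:C%C) :> Cplx R.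
  by rewrite -[RHS]/(oppc (mulc _ _)) /=; simpc.
(* Each entry of the partial sums is a fixed linear combination of the partial sums of the cosine
   and sine series. *)
move=> A2; apply: cvg_mx_lim; apply/cvg_mxP => i j.
rewrite !mxE (imE (sin t)) mulNr.
rewrite (_ : (fun N => _) = fun N =>
    ((series (cos_coeff t) N)%:C%C : Cplx R) * (i == j)%:R -
    ('i%C : Cplx R) * (series (sin_coeff t) N)%:C%C * A i j); last first.
  apply/funext => N; rewrite !seriesEord /= summxE !rmorph_sum /=.
  rewrite mulr_suml mulr_sumr mulr_suml -sumrB; apply: eq_bigr => k _.
  by rewrite expmx_coeff_invol // !mxE (imE (sin_coeff t k)) mulNr.
have cvg_cos := cvg_real_complex _ (@is_cvg_series_cos_coeff R t).
have cvg_sin := cvg_real_complex _ (@is_cvg_series_sin_coeff R t).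
(* Unlocking exposes [cos t] and [sin t] as the limits of their series. *)
rewrite !unlock; apply: cvgB; apply: cvgM;
  [exact: cvg_cos|exact: cvg_cst| |exact: cvg_cst].
by apply: cvgM; [exact: cvg_cst|exact: cvg_sin].
Qed.

(** A permutation is injective, hence preserves [u != v]: it is an automorphism of the complete
    graph. *)
Lemma complete_graph_perm_comm (R : realType) (n : nat) (z : Cplx R)
    (s : 'S_n) :
  GRing.comm (perm_mx s) (z *: adjmx R (complete_graph n)).
Proof.
suff: perm_mx s *m (z *: adjmx R (complete_graph n)) =
    (z *: adjmx R (complete_graph n)) *m perm_mx s by [].
rewrite -row_permE -[s in RHS]invgK -col_permE.
apply/matrixP => i j; rewrite !mxE /=.
by rewrite /complete_adj (can2_eq (permK s) (permKV s)).
Qed.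

Lemma adjmx_complete_graph2_invol (R : realType) :
  adjmx R (complete_graph 2) ^+ 2 = 1.
Proof.
rewrite expr2; apply/matrixP => i j; rewrite mxE big_ord_recl big_ord1 !mxE /=.
rewrite /complete_adj -!(inj_eq val_inj) /=.
by case: i j => [[|[|//]] ?] [[|[|//]] ?] /=;
  rewrite ?(mulr0, mul0r, mulr1, addr0, add0r).
Qed.

Theorem theorem4p9 (R : realType) (n : nat) :
  PGFR R (complete_graph n) <-> n = 2.
Proof.
split=> [[a [b [ab [t [alpha [beta [Hcvg beta0 _]]]]]]]|->].
  have [c /andP[ac cb]|noc] := pickP [pred c | (a != c) && (c != b)]; last first.
    (* Without a third vertex, [a] and [b] exhaust ['I_n], and counting gives [n = 2]. *)
    rewrite -(card_ord n) -cardsT (_ : [set: 'I_n]%SET = [set a; b]%SET).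
      by rewrite cards2 ab.
    apply/setP => c; rewrite !inE; apply/esym.
    by have /= := noc c; rewrite (eq_sym a); do 2!case: eqP.
  move/cvg_mxP : Hcvg => Hcvg.
  have Hbc k : (transition (complete_graph n) (t k) *m evec R a) b ord0 =
      (transition (complete_graph n) (t k) *m evec R a) c ord0.
    rewrite /evec -!colE !mxE; apply: expmx_comm_tperm_coord => //.
    exact: complete_graph_perm_comm.
  have Hc := Hcvg c ord0; have := Hcvg b ord0; rewrite (funext Hbc) => Hb.
  (* [Hb] and [Hc] now give two limits of the same sequence, the entry at [c]. *)
  have := @cvg_unique (Cplx R) (@norm_hausdorff _ (Cplx R)) _ _ _ _ Hb Hc.
  rewrite !mxE !eqxx (eq_sym b) (eq_sym c) (negPf ab) (negPf ac) (negPf cb).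
  rewrite !mulr0 !add0r mulr1 => beta_eq0.
  by move/eqP : beta0; case; exact: beta_eq0.
exists ord0, ord_max; split => //.
(* The limit state is attained exactly at time [pi / 2], so a constant sequence suffices. *)
exists (fun=> pi / 2), 0, (- ('i%C : Cplx R)); split; last 2 first.
- by rewrite oppr_eq0 eq_complex /= oner_eq0 andbF.
- by rewrite normrN normr0 expr0n add0r normc_def /= expr0n expr1n add0r
     sqrtr1 expr1n.
rewrite /transition expmx_invol ?adjmx_complete_graph2_invol //.
rewrite cos_pihalf sin_pihalf.
rewrite (_ : _ *m _ = 0 *: evec R ord0 + - ('i%C : Cplx R) *: evec R ord_max).
  exact: cvg_cst.
apply/matrixP => i j; rewrite /evec -colE !mxE /=.
(* On two vertices, being [ord_max] is the same as being adjacent to [ord0]. *)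
rewrite ord1 !eqxx !andbT !mul0r !add0r (_ : i == ord_max = complete_adj i ord0).
  by congr (_ * _); apply/eqP; rewrite eq_complex /= oppr0 !eqxx.
by case: i => [[|[|//]] ?].
Qed.
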